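(* Let $C=C_{\rm comp}\otimes C_0$, a $[N(n_0+1),Kk_0]_{\mathbb F}$ code, and let $D=C^\perp$. Suppose there exist $Km$ dual codewords $h^{(1)},\dots,h^{(Km)}\in D$, written $h^{(i)}=(h^{(i)}_{1},\dots,h^{(i)}_{N})$ with $h^{(i)}_{s}=(h^{(i)}_{s,0},\dots,h^{(i)}_{s,n_0})\in\mathbb F^{n_0+1}$, such that: (i) the matrix $$A=\begin{bmatrix} h_{1,0}^{(1)}&h_{2,0}^{(1)}&\cdots&h_{N,0}^{(1)}\\ \vdots&\vdots&&\vdots\\ h_{1,0}^{(Km)}&h_{2,0}^{(Km)}&\cdots&h_{N,0}^{(Km)}\end{bmatrix}\cdot G_{\rm comp}^T\in\mathbb F^{Km\times K}$$ satisfies $\operatorname{rank}_{\mathbb B}(A^{\mathbb B})=Km$; and (ii) for every $(s,j)\in\{1,\dots,N\}\times\{1,\dots,n_0\}$, $\dim_{\mathbb B}\operatorname{span}_{\mathbb B}\{h^{(1)}_{s,j},\dots,h^{(Km)}_{s,j}\}=1$. Then there exists an equally distributed linear exact repair scheme for $C$ over $\mathbb B$.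
   Context: $\mathbb B=\mathbb F_q$ is a finite field and $\mathbb F$ is an extension field of $\mathbb B$ of degree $m$. An $[\ell,k]_{\mathbb F}$ code is a $k$-dimensional $\mathbb F$-linear subspace of $\mathbb F^{\ell}$; duals are with respect to the standard bilinear form $\sum_i x_iy_i$. Base code: $C_0$ is an $[n_0+1,k_0]_{\mathbb F}$ code, with coordinates indexed by $0,\dots,n_0$, admitting a generator matrix (with $k_0$ linearly independent rows) of the form $G_0=\begin{bmatrix}-1&\phi\\0&\overline{G_0}\end{bmatrix}$, where $\phi\in\mathbb F^{n_0}$ is nonzero and $\overline{G_0}\in\mathbb F^{(k_0-1)\times n_0}$. Computation code: let $1\le K<N$ and let $H_{\rm comp}\in\mathbb F^{(N-K)\times N}$ be a matrix whose $i$-th row ($1\le i\le N-K$) is $(g_{i,1},\dots,g_{i,K+i-1},-1,0,\dots,0)$, with $-1$ in column $K+i$ and arbitrary $g_{i,l}\in\mathbb F$. Then $C_{\rm comp}=\{c\in\mathbb F^N: H_{\rm comp}c^T=0\}$ is an $[N,K]_{\mathbb F}$ code, and $G_{\rm comp}\in\mathbb F^{K\times N}$ is its systematic generator matrix, whose first $K$ columns form the identity matrix. Product code: $C_{\rm comp}\otimes C_0$ is the code generated by the Kronecker product $G_{\rm comp}\otimes G_0$. Its codewords are written $c=(c_1,\dots,c_N)$ with $c_s=(c_{s,0},\dots,c_{s,n_0})\in C_0$; they satisfy $(c_{1,j},\dots,c_{N,j})=(c_{1,j},\dots,c_{K,j})\,G_{\rm comp}$ for every $j\in\{0,\dots,n_0\}$.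 The input secrets are $c_{1,0},\dots,c_{K,0}$. Row expansion: fix a basis of $\mathbb F$ over $\mathbb B$. For $M\in\mathbb F^{a\times b}$, $M^{\mathbb B}\in\mathbb B^{a\times bm}$ is obtained by replacing each entry by the row vector of its $m$ coordinates in this basis. Equally distributed linear exact repair scheme (LERS) for $C$: $\mathbb B$-linear maps $g_{s,j}:\mathbb F\to\mathbb B$ for $1\le s\le N$, $1\le j\le n_0$ (one $\mathbb B$-symbol is queried from each share), together with a $\mathbb B$-linear reconstruction map $R:\mathbb B^{Nn_0}\to\mathbb F^K$ such that for every $c\in C$, $R\bigl((g_{s,j}(c_{s,j}))_{1\le s\le N,\,1\le j\le n_0}\bigr)=(c_{1,0},\dots,c_{K,0})$. *)

(* Defs.v *)
From mathcomp Require Import all_boot all_order all_algebra all_field.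
From mathcomp Require Export mxtens.

Set Implicit Arguments.
Unset Strict Implicit.
Unset Printing Implicit Defensive.

Import GRing.Theory.
Local Open Scope ring_scope.

(* All indices start from 0. A linear code of length l is represented by a
   generator matrix G : 'M_(k, l); its codewords are the row vectors c with
   (c <= G)%MS. *)

Section Codes.
Variable F : fieldType.

Definition dual_codeword (k l : nat) (G : 'M[F]_(k, l)) (d : 'rV[F]_l) : Prop :=
  forall c : 'rV[F]_l, (c <= G)%MS -> \sum_i d 0 i * c 0 i = 0.

(* Coordinate 0 of the base code carries the secret, coordinates 1, ..., n0
   (that is, lift ord0 j for j : 'I_n0) carry the shares. *)
Definition base_gen (k n0 : nat) (phi : 'rV[F]_n0) (G0bar : 'M[F]_(k, n0)) :
    'M[F]_(k.+1, n0.+1) :=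
  block_mx (-1)%:M phi 0 G0bar.

(* The entries H i j with j < K + i are unconstrained. *)
Definition comp_check_matrix (K N : nat) (H : 'M[F]_(N - K, N)) : Prop :=
  forall (i : 'I_(N - K)) (j : 'I_N),
    (j = (K + i)%N :> nat -> H i j = -1) /\ ((K + i < j)%N -> H i j = 0).

Definition systematic_generator (K N r : nat)
    (H : 'M[F]_(r, N)) (G : 'M[F]_(K, N)) : Prop :=
  (forall (i : 'I_K) (j : 'I_N), (j < K)%N -> G i j = (i == j :> nat)%:R) /\
  (forall c : 'rV[F]_N, (c <= G)%MS <-> H *m c^T = 0).

(* The coordinate c_{s,j} of a word c of length N * n; mxtens_index is the
   indexing of columns used by the Kronecker product A *t B. *)
Definition coordinate (N n : nat) (c : 'rV[F]_(N * n)) (s : 'I_N) (j : 'I_n) : F :=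
  c 0 (mxtens_index (s, j)).

Lemma row_free_tens (a b c d : nat) (A : 'M[F]_(a, b)) (B : 'M[F]_(c, d)) :
  row_free A -> row_free B -> row_free (A *t B).
Proof.
move=> /row_freeP[A' hA] /row_freeP[B' hB]; apply/row_freeP.
exists (A' *t B'); rewrite tensmx_mul hA hB.
apply/matrixP => x y; case: (mxtens_indexP x) => i j.
case: (mxtens_indexP y) => k l; rewrite tensmxE !mxE.
by rewrite (can_eq (@mxtens_indexK _ _)) xpair_eqE -natrM mulnb.
Qed.

Lemma systematic_row_free (K N r : nat) (H : 'M[F]_(r, N)) (G : 'M[F]_(K, N)) :
  (K <= N)%N -> systematic_generator H G -> row_free G.
Proof.
move=> hKN [hG _]; apply/row_freeP.
exists (\matrix_(s, i) (s == i :> nat)%:R); apply/matrixP => i j; rewrite !mxE.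
rewrite (bigD1 (widen_ord hKN i)) //= big1 ?addr0; last first.
  move=> s hs; rewrite mxE; case: eqP => [e|_]; last by rewrite mulr0.
  rewrite hG ?e // mulr1; case: eqP => // eij; case/eqP: hs.
  by apply/val_inj; rewrite /= eij e.
by rewrite hG /= ?eqxx ?mul1r ?mxE.
Qed.

Lemma rank_product_code (K N r k0 l : nat) (H : 'M[F]_(r, N))
    (G : 'M[F]_(K, N)) (G0 : 'M[F]_(k0, l)) :
  (K <= N)%N -> systematic_generator H G -> row_free G0 ->
  \rank (G *t G0) = (K * k0)%N.
Proof.
by move=> hKN hG h0; apply/eqP/row_free_tens/h0/(systematic_row_free hKN hG).
Qed.

End Codes.

Section OverSubfield.
Variables (B : finFieldType) (F : fieldExtType B).

Definition row_expansion (m : nat) (e : m.-tuple F) (a b : nat)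
    (M : 'M[F]_(a, b)) : 'M[B]_(a, b * m) :=
  \matrix_(i < a, t < b * m)
    coord e (mxtens_unindex t).2 (M i (mxtens_unindex t).1).

(* The B-space F^K is {ffun 'I_K -> F}, since 'rV[F]_K is only an F-module for
   the library; likewise the N * n0 answers are collected in an N x n0 matrix. *)
Definition has_LERS (K N n0 k : nat) (hKN : (K <= N)%N)
    (C : 'M[F]_(k, N * n0.+1)) : Prop :=
  exists (g : 'I_N -> 'I_n0 -> {linear F -> B^o})
         (R : {linear 'M[B]_(N, n0) -> {ffun 'I_K -> F}}),
    forall c : 'rV[F]_(N * n0.+1), (c <= C)%MS ->
      R (\matrix_(s < N, j < n0) g s j (coordinate c s (lift ord0 j)))
      = [ffun i : 'I_K => coordinate c (widen_ord hKN i) ord0].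

End OverSubfield.

(* Main.v *)
Require Import Defs.
From HB Require Import structures.
From mathcomp Require Import all_boot all_order all_algebra all_field.

Set Implicit Arguments.
Unset Strict Implicit.
Unset Printing Implicit Defensive.

Import GRing.Theory.
Local Open Scope ring_scope.

(** Because a word of the product code satisfies c_{s,0} = sum_p c_{p,0} G_{p,s},
  each dual codeword h^(i) turns into a parity check
  sum_p A_{i,p} c_{p,0} = - sum_{s, j >= 1} h^(i)_{s,j} c_{s,j} on the secrets.
  Fix a nonzero B-linear functional L on F.  By (ii), h^(i)_{s,j} = b_{i,s,j} w_{s,j}
  with b_{i,s,j} in B, so all the values L (sum_p A_{i,p} c_{p,0}) are computed
  B-linearly from the single symbols L (w_{s,j} c_{s,j}).  By (i) the rows of A
  span F^K over B, and (x, y) |-> L (x y) is nondegenerate, so these values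
  determine the secrets. *)

Lemma sum_mxtens_index (V : nmodType) (a b : nat) (f : 'I_(a * b) -> V) :
  \sum_i f i = \sum_i \sum_j f (mxtens_index (i, j)).
Proof.
rewrite pair_big /= (reindex (@mxtens_index a b)) /=.
  by apply: eq_bigr => -[].
exists (@mxtens_unindex a b) => i _; first exact: mxtens_indexK.
exact: mxtens_unindexK.
Qed.

(** Writing [c] as [v *m (G *t G0)] gives c_{t,j} = sum_p x_p G_{p,t}, where x_p does not depend on
    t. The identity block of [G] then identifies x_p with c_{p,j}. *)
Lemma product_code_coordinate (F : fieldType) (K N r k n : nat) (hKN : (K <= N)%N)
    (H : 'M[F]_(r, N)) (G : 'M[F]_(K, N)) (G0 : 'M[F]_(k, n)) (c : 'rV[F]_(N * n)) :
    systematic_generator H G -> (c <= G *t G0)%MS ->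
  forall s j,
    coordinate c s j = \sum_p coordinate c (widen_ord hKN p) j * G p s.
Proof.
move=> [hG _] /submxP[v ->] s j; rewrite /coordinate.
pose x p := \sum_q v 0 (mxtens_index (p, q)) * G0 q j.
have vE t : (v *m (G *t G0)) 0 (mxtens_index (t, j)) = \sum_p x p * G p t.
  rewrite mxE sum_mxtens_index; apply: eq_bigr => p _.
  by rewrite mulr_suml; apply: eq_bigr => q _; rewrite tensmxE mulrCA mulrC.
rewrite vE; apply: eq_bigr => p _; congr (_ * _).
rewrite vE (bigD1 p) //= hG /= ?eqxx ?mulr1 // big1 ?addr0 // => q neq_qp.
by rewrite hG //= (inj_eq val_inj) (negPf neq_qp) mulr0.
Qed.

Lemma dual_codeword_secrets (F : fieldType) (K N r k n : nat) (hKN : (K <= N)%N)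
    (H : 'M[F]_(r, N)) (G : 'M[F]_(K, N)) (G0 : 'M[F]_(k, n.+1))
    (d c : 'rV[F]_(N * n.+1)) :
    systematic_generator H G -> dual_codeword (G *t G0) d -> (c <= G *t G0)%MS ->
  \sum_p (\sum_s coordinate d s ord0 * G p s) * coordinate c (widen_ord hKN p) ord0
  = - \sum_s \sum_j coordinate d s (lift ord0 j) * coordinate c s (lift ord0 j).
Proof.
move=> hG /(_ c) hd hc; move: (hd hc); rewrite sum_mxtens_index.
under eq_bigr do rewrite big_ord_recl.
rewrite big_split /= => /eqP; rewrite addr_eq0 => /eqP <-.
under eq_bigr do rewrite mulr_suml.
rewrite exchange_big /=; apply: eq_bigr => s _.
rewrite -/(coordinate c s ord0) (product_code_coordinate hKN hG hc) mulr_sumr.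
apply: eq_bigr => p _.
by rewrite -mulrA [G p s * _]mulrC.
Qed.

Section OverSubfield.
Variables (B : finFieldType) (F : fieldExtType B).

(** Full column rank over [B] puts the coordinate vector of [y] in the row space of the expansion;
    recombining each block of [m] coordinates with the basis [e] turns this into an identity over
    [F]. *)
Lemma row_expansion_span (m : nat) (e : m.-tuple F) (a b : nat) (M : 'M[F]_(a, b)) :
    basis_of {:F} e -> row_full (row_expansion e M) ->
  forall y : 'I_b -> F,
    exists v : 'I_a -> B, forall p, y p = \sum_i v i *: M i p.
Proof.
move=> he hM y.
have /submxP[v hv] : (row_expansion e (\row_p y p) <= row_expansion e M)%MS.
  exact: submx_full.
exists (v 0) => p.
rewrite (coord_basis he (memvf (y p))).
under [RHS]eq_bigr => i _ do
  rewrite (coord_basis he (memvf (M i p))) scaler_sumr.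
rewrite exchange_big /=; apply: eq_bigr => t _.
under [RHS]eq_bigr do rewrite scalerA.
rewrite -scaler_suml; congr (_ *: _).
have := congr1 (fun A : 'rV_(b * m) => A 0 (mxtens_index (p, t))) hv.
rewrite !mxE mxtens_indexK /= => ->.
by apply: eq_bigr => i _; rewrite mxE mxtens_indexK.
Qed.

(** A one-dimensional span is the line through any of its nonzero vectors, here [vpick U]. *)
Lemma dim1_span_factor (I : finType) (f : I -> F) :
    \dim <<[seq f i | i : I]>> = 1%N ->
  exists w : F, exists b : I -> B, forall i, f i = b i *: w.
Proof.
set U := <<_>>%VS => hU; exists (vpick U).
have U_line : U = <[vpick U]>%VS.
  apply/esym/eqP; rewrite eqEdim -memvE memv_pick hU dim_vline vpick0.
  by rewrite -dimv_eq0 hU.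
apply: (fin_all_exists (P := fun i a => f i = a *: vpick U)) => i.
apply/vlineP; rewrite -U_line.
exact/memv_span/image_f.
Qed.

End OverSubfield.

Theorem theorem4
  (B : finFieldType) (F : fieldExtType B)
  (m : nat) (hm : \dim {:F} = m)
  (e : m.-tuple F) (he : basis_of {:F} e)
  (n0 k : nat) (phi : 'rV[F]_n0) (hphi : phi != 0)
  (G0bar : 'M[F]_(k, n0)) (hG0 : row_free (base_gen phi G0bar))
  (K N : nat) (hK : (1 <= K)%N) (hKN : (K < N)%N)
  (Hcomp : 'M[F]_(N - K, N)) (hHcomp : comp_check_matrix Hcomp)
  (Gcomp : 'M[F]_(K, N)) (hGcomp : systematic_generator Hcomp Gcomp)
  (h : 'I_(K * m) -> 'rV[F]_(N * n0.+1))
  (hdual : forall i, dual_codeword (Gcomp *t base_gen phi G0bar) (h i))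
  (hrank : \rank (row_expansion e
      ((\matrix_(i < K * m, s < N) coordinate (h i) s ord0) *m Gcomp^T))
    = (K * m)%N)
  (hdim : forall (s : 'I_N) (j : 'I_n0),
    \dim <<[seq coordinate (h i) s (lift ord0 j) | i : 'I_(K * m)]>> = 1%N) :
  has_LERS (ltnW hKN) (Gcomp *t base_gen phi G0bar).
Proof.
set A := (_ *m Gcomp^T) in hrank.
have m_gt0 : (0 < m)%N by rewrite -hm adim_gt0.
pose L : {linear F -> B^o} := coord e (Ordinal m_gt0).
have [z Lz] : exists z, L z != 0.
  exists e`_(Ordinal m_gt0).
  by rewrite /L /= (coord_free (Ordinal m_gt0) _ (basis_free he)) eqxx oner_neq0.
(* The multiplier [w] depends on the share only, not on the dual codeword [i]; this is why one
   symbol per share serves all the parity checks. *)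
have [w hw] : exists w : 'I_N * 'I_n0 -> F, forall u, exists b : 'I_(K * m) -> B,
    forall i, coordinate (h i) u.1 (lift ord0 u.2) = b i *: w u.
  apply: (fin_all_exists (P := fun u x => exists b : 'I_(K * m) -> B,
    forall i, coordinate (h i) u.1 (lift ord0 u.2) = b i *: x)) => u.
  exact/dim1_span_factor/hdim.
have [b hb] := fin_all_exists hw.
pose T0 (x : {ffun 'I_K -> F}) : 'rV[B]_(K * m) :=
  \row_i L (\sum_p A i p * x p).
have T0_lin : linear T0.
  move=> a x y; apply/rowP => i; rewrite !mxE -[a * _]/(a *: (_ : B^o)) -linearP.
  congr (L _); rewrite scaler_sumr -big_split; apply: eq_bigr => p _.
  by rewrite !ffunE mulrDr scalerAr.
pose T : {linear {ffun 'I_K -> F} -> 'rV[B]_(K * m)} :=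
  HB.pack T0 (GRing.isLinear.Build _ _ _ _ T0 T0_lin).
have kerT : lker (linfun T) == 0%VS.
  rewrite -subv0; apply/subvP => x; rewrite memv_ker memv0 lfunE /=.
  move=> /eqP/rowP Tx0; apply/eqP/ffunP => p; rewrite ffunE; apply/eqP.
  (* If x_p is nonzero, the vector with z / x_p in position p and 0 elsewhere is a [B]-combination
     of the rows of [A]. Pairing it with [x] gives z, so L z is a combination of the entries of T x,
     which all vanish. *)
  apply: contraNT Lz => xp_neq0.
  have full : row_full (row_expansion e A) by rewrite /row_full hrank.
  have [v hv] := row_expansion_span he full
    (fun q => if q == p then z / x p else 0).
  have -> : z = \sum_i v i *: \sum_q A i q * x q.
    under eq_bigr do rewrite scaler_sumr.
    rewrite exchange_big (bigD1 p) //= [X in _ + X]big1 => [|q neq_qp].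
      under eq_bigr do rewrite scalerAl.
      by rewrite -mulr_suml -hv eqxx divfK // addr0.
    under eq_bigr do rewrite scalerAl.
    by rewrite -mulr_suml -hv (negPf neq_qp) mul0r.
  rewrite linear_sum big1 // => i _; rewrite linearZ /=.
  by have := Tx0 i; rewrite !mxE => ->; rewrite scaler0.
(* The right-hand sides of the parity checks, after applying [L], as functions of the answers
   alone. *)
pose S0 (Y : 'M[B]_(N, n0)) : 'rV[B]_(K * m) :=
  \row_i - \sum_s \sum_j b (s, j) i * Y s j.
have S0_lin : linear S0.
  move=> a X Y; apply/rowP => i; rewrite !mxE mulrN -opprD; congr (- _).
  rewrite mulr_sumr -big_split; apply: eq_bigr => s _.
  rewrite mulr_sumr -big_split; apply: eq_bigr => j _.
  by rewrite !mxE mulrDr mulrCA.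
pose S : {linear 'M[B]_(N, n0) -> 'rV[B]_(K * m)} :=
  HB.pack S0 (GRing.isLinear.Build _ _ _ _ S0 S0_lin).
(* The share y at (s, j) answers L (w_{s,j} y). *)
exists (fun s j => (L \o amull (w (s, j)) : {linear F -> B^o})).
exists ((linfun T)^-1%VF \o S : {linear _ -> _}) => c hc /=.
(* As [T] is injective, its inverse cancels it on the secrets, and it remains to see that [S] of the
   answers equals [T] of the secrets. *)
rewrite -[RHS](lker0_lfunK kerT); congr (_^-1%VF _).
rewrite lfunE /=; apply/rowP => i; rewrite !mxE.
under [in RHS]eq_bigr => p _ do rewrite ffunE !mxE.
under [in RHS]eq_bigr => p _ do under eq_bigr => s _ do rewrite !mxE.
rewrite (dual_codeword_secrets _ hGcomp (hdual i) hc) linearN linear_sum.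
congr (- _); apply: eq_bigr => s _; rewrite linear_sum; apply: eq_bigr => j _.
by rewrite mxE /= lfunE /= (hb (s, j)) -scalerAl linearZ.
Qed.
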